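(* Let $\{\nu_k\}$ be any sequence of positive numbers increasing to infinity, and let $\{n_k\}$ be the sequence defined in the context. Define $\{a_j\}_{j\ge 0}$ by $$a_j=\nu_k\frac{g(n_k)}{\log n_k}\quad\text{when } j=n_{k-1}+4^m,\ \ 0\le m\le \log_4\frac{n_k}{2}\quad(k\ge 1,\ m\in\mathbf Z),$$ and $a_j=0$ otherwise. Then there is a constant $C$ such that for all $k\ge1$ $$\Big(\sum_{j=n_{k-1}+1}^{n_k}a_j^2\Big)^{1/2}\le C\,\nu_k\frac{g(n_k)}{\sqrt{\log n_k}},$$ but $u(z,\xi)=\sum_{j=0}^\infty a_j\xi_j r^j\cos j\theta$ ($z=re^{i\theta}$) does not belong to $h^\infty_v(\mathbf D)$ for any choice of sequence $\{\xi_j\}$ with $\xi_j=\pm1$.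
   Context: $\mathbf D$ is the open unit disk. The weight $v$ is a positive increasing continuous function on $[0,1)$ with $v(0)=1$, $\lim_{r\to 1}v(r)=+\infty$, satisfying $v(1-t)\le D\,v(1-2t)$ for $0<t\le 1/2$ and some constant $D$. Put $g(x)=v(1-1/x)$ for $x\ge 1$, so $g(2x)\le D g(x)$. $h^\infty_v(\mathbf D)$ is the set of harmonic functions $u:\mathbf D\to\mathbf R$ with $|u(z)|\le K v(|z|)$ on $\mathbf D$ for some $K>0$. Let $c>0$ be an absolute constant such that $\big\|\sum_{j=1}^n c_j\cos\big((N+4^j)\theta\big)\big\|_\infty\ge c\sum_{j=1}^n|c_j|$ for all $N$, all $n$ and all real $c_j$ (sup norm over $\theta$). Fix $A>1$ with $\frac{1}{A-1}\le\frac c8$, and define $n_0=2$ and $n_{k+1}=\min\{l\in\mathbf N: g(l)\ge A\,g(n_k)\}$, where $A$ is moreover chosen large enough that $n_k\ge 4n_{k-1}$ for all $k\ge 1$. *)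

(* Defs.v *)
From Stdlib Require Import Reals.
From Coquelicot Require Import Coquelicot.
Open Scope R_scope.

(* Only the values of [v] on [0,1) matter, so continuity is that of the
   restriction of [v] to [0,1): at 0 it is one-sided.  "Increasing" is taken
   in the wide sense. *)
Definition is_weight (v : R -> R) : Prop :=
  (forall r, 0 <= r < 1 -> 0 < v r) /\
  (forall r s, 0 <= r -> r <= s -> s < 1 -> v r <= v s) /\
  continuous_on (fun r => 0 <= r < 1) v /\
  v 0 = 1 /\
  filterlim v (at_left 1) (Rbar_locally p_infty) /\
  (exists D : R, forall t, 0 < t <= 1 / 2 -> v (1 - t) <= D * v (1 - 2 * t)).

(* Meaningful for [1 <= x] only. *)
Definition weight_g (v : R -> R) (x : R) : R := v (1 - 1 / x).

Definition in_disk (z : C) : Prop := Cmod z < 1.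

(* [ex_diff_n f 2] at every point of the open disk says that [f] is of
   class C^2 there. *)
Definition harmonic_on_disk (u : C -> R) : Prop :=
  let f := fun x y : R => u (x, y) in
  forall z : C, in_disk z ->
    ex_diff_n f 2 (fst z) (snd z) /\
    partial_derive 2 0 f (fst z) (snd z)
      + partial_derive 0 2 f (fst z) (snd z) = 0.

(* The growth space h^infty_v; a function on the disk is represented by a
   total function on [C], whose values off the disk are irrelevant. *)
Definition h_infty (v : R -> R) (u : C -> R) : Prop :=
  harmonic_on_disk u /\
  exists K : R, 0 < K /\ forall z : C, in_disk z -> Rabs (u z) <= K * v (Cmod z).

(* The value [p_infty] is taken when [f] is unbounded. *)
Definition sup_norm (f : R -> R) : Rbar :=
  Lub_Rbar (fun y => exists theta : R, y = Rabs (f theta)).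

Definition cosine_lower_bound (c : R) : Prop :=
  forall (N n : nat) (cs : nat -> R),
    Rbar_le (c * sum_n_m (fun j => Rabs (cs j)) 1 n)
      (sup_norm (fun theta =>
         sum_n_m (fun j => cs j * cos (INR (N + 4 ^ j) * theta)) 1 n)).

Definition is_min_nat (P : nat -> Prop) (m : nat) : Prop :=
  P m /\ forall l : nat, P l -> (m <= l)%nat.

(* [l] ranges over the positive integers, where [weight_g v] is meaningful. *)
Definition is_growth_sequence (v : R -> R) (A : R) (n : nat -> nat) : Prop :=
  n 0%nat = 2%nat /\
  forall k : nat,
    is_min_nat
      (fun l => (1 <= l)%nat /\
                weight_g v (INR l) >= A * weight_g v (INR (n k)))
      (n (S k)).

Definition block_index (n : nat -> nat) (k m j : nat) : Prop :=
  (1 <= k)%nat /\ INR m <= Rlog 4 (INR (n k) / 2) /\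
  j = (n (k - 1) + 4 ^ m)%nat.

Definition is_block_coeffs (v : R -> R) (n : nat -> nat) (nu a : nat -> R)
    : Prop :=
  (forall k m j : nat, block_index n k m j ->
     a j = nu k * (weight_g v (INR (n k)) / ln (INR (n k)))) /\
  (forall j : nat, ~ (exists k m : nat, block_index n k m j) -> a j = 0).

(* The cosine series with coefficients [b] converges at every point of the
   disk, with sum [u]. *)
Definition is_cos_series_sum (b : nat -> R) (u : C -> R) : Prop :=
  forall r theta : R, 0 <= r < 1 ->
    is_series (fun j => b j * r ^ j * cos (INR j * theta))
      (u (r * cos theta, r * sin theta)).

(* Main.v *)
Require Import Defs.
From Stdlib Require Import Reals Lra Lia.
From Coquelicot Require Import Coquelicot.
Open Scope R_scope.

(** Suppose [u] lies in [h_infty v], so that [|u| <= K v(r)] on the circle of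
    radius [r = 1 - 1/(16 n_k)]; doubling gives [v(r) <= E g(n_k)].  Fejér means
    do not increase the sup norm, and the [n_k]-th one kills every frequency
    beyond block [k].  By geometric growth of [g(n_i)] the blocks before the
    [k]-th contribute at most [const * nu_k g(n_k) / (A - 1)], while the
    hypothesis on lacunary cosine sums bounds block [k] from below by
    [const * c nu_k g(n_k)] with a larger constant, as [1/(A - 1) <= c/8].
    Hence [nu_k] stays bounded, contradicting [nu_k -> infinity]. *)

(** * Finite sums of reals *)

Lemma sum_n_Sn (f : nat -> R) (n : nat) :
  (sum_n f (S n) : R) = sum_n f n + f (S n).
Proof. exact (sum_Sn f n). Qed.

Lemma sum_n_m_eq_loc (f g : nat -> R) (a b : nat) :
  (forall i, (a <= i <= b)%nat -> f i = g i) ->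
  (sum_n_m f a b : R) = sum_n_m g a b.
Proof. exact (sum_n_m_ext_loc f g a b). Qed.

Lemma sum_n_eq (f g : nat -> R) (n : nat) :
  (forall i, f i = g i) -> (sum_n f n : R) = sum_n g n.
Proof. exact (sum_n_ext f g n). Qed.

Lemma sum_n_m_add (f g : nat -> R) (a b : nat) :
  sum_n_m (fun i => f i + g i) a b = sum_n_m f a b + sum_n_m g a b.
Proof. exact (sum_n_m_plus f g a b). Qed.

Lemma sum_n_m_Rmult_l (x : R) (f : nat -> R) (a b : nat) :
  sum_n_m (fun i => x * f i) a b = x * sum_n_m f a b.
Proof. exact (sum_n_m_mult_l (K := R_Ring) x f a b). Qed.

Lemma sum_n_m_Rabs_le (f : nat -> R) (a b : nat) :
  Rabs (sum_n_m f a b) <= sum_n_m (fun i => Rabs (f i)) a b.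
Proof. exact (norm_sum_n_m (V := R_NormedModule) f a b). Qed.

Lemma sum_n_m_le_loc (f g : nat -> R) (a b : nat) :
  (forall i, (a <= i <= b)%nat -> f i <= g i) ->
  sum_n_m f a b <= sum_n_m g a b.
Proof.
  intros H.
  (* Cutting both functions off to 0 outside [[a, b]] makes the inequality hold at every index, as
     [sum_n_m_le] asks. *)
  set (f' := fun i => if andb (Nat.leb a i) (Nat.leb i b) then f i else 0).
  set (g' := fun i => if andb (Nat.leb a i) (Nat.leb i b) then g i else 0).
  assert (E : forall i, (a <= i <= b)%nat ->
            andb (Nat.leb a i) (Nat.leb i b) = true).
  { intros i Hi. apply andb_true_intro; split; apply Nat.leb_le; lia. }
  rewrite (sum_n_m_eq_loc f f') by (intros i Hi; unfold f'; now rewrite E).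
  rewrite (sum_n_m_eq_loc g g') by (intros i Hi; unfold g'; now rewrite E).
  apply sum_n_m_le. intros i. unfold f', g'.
  destruct (Nat.leb_spec a i); destruct (Nat.leb_spec i b); simpl;
    try lra; apply H; lia.
Qed.

Lemma sum_n_m_Chasles_R (f : nat -> R) (a m b : nat) :
  (a <= S m)%nat -> (m <= b)%nat ->
  sum_n_m f a b = sum_n_m f a m + sum_n_m f (S m) b.
Proof. exact (sum_n_m_Chasles f a m b). Qed.

Lemma sum_n_m_zero_loc (f : nat -> R) (a b : nat) :
  (forall i, (a <= i <= b)%nat -> f i = 0) -> (sum_n_m f a b : R) = 0.
Proof.
  intros H. rewrite (sum_n_m_eq_loc _ (fun _ => 0) _ _ H).
  rewrite sum_n_m_const. apply Rmult_0_r.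
Qed.

(** * Fejér means, computed by averaging over the [L]-th roots of unity *)

Definition node (L l : nat) : R := 2 * PI * INR l / INR L.

(** The angles advance by the constant step [2 * h], so multiplication by [2 * sin h] telescopes the
    sum. Over [S K] nodes the total advance is [m] full turns, and [sin h] is nonzero because
    [0 < m < S K]. *)
Lemma sum_cos_node (K m : nat) (alpha : R) :
  (0 < m < S K)%nat ->
  (sum_n (fun l => cos (alpha + INR m * node (S K) l)) K : R) = 0.
Proof.
  intros Hm.
  set (h := INR m * PI / INR (S K)).
  assert (HL : 0 < INR (S K)) by (apply lt_0_INR; lia).
  assert (Hm0 : 0 < INR m) by (apply lt_0_INR; lia).
  assert (HmL : INR m < INR (S K)) by (apply lt_INR; lia).
  pose proof PI_RGT_0 as HPI.
  assert (Hs : 0 < sin h).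
  { apply sin_gt_0; unfold h.
    - apply Rdiv_lt_0_compat; nra.
    - apply Rmult_lt_reg_r with (INR (S K)); auto.
      unfold Rdiv. rewrite Rmult_assoc, Rinv_l by lra. nra. }
  assert (Htel : forall p, 2 * sin h
      * sum_n (fun l => cos (alpha + INR m * node (S K) l)) p
      = sin (alpha + (2 * INR p + 1) * h) - sin (alpha - h)).
  { assert (Hc : forall l, alpha + INR m * node (S K) l = alpha + 2 * INR l * h).
    { intros l. unfold node, h. field. lra. }
    assert (Hp : forall x, 2 * sin h * cos x = sin (x + h) - sin (x - h)).
    { intros x. rewrite sin_plus, sin_minus. ring. }
    induction p as [|p IH].
    - rewrite sum_O, Hc, Hp. simpl (INR 0). f_equal; f_equal; ring.
    - rewrite sum_n_Sn, Rmult_plus_distr_l, IH, Hc, Hp, !S_INR.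
      replace (alpha + 2 * (INR p + 1) * h - h)
        with (alpha + (2 * INR p + 1) * h) by ring.
      replace (alpha + 2 * (INR p + 1) * h + h)
        with (alpha + (2 * (INR p + 1) + 1) * h) by ring.
      ring. }
  specialize (Htel K).
  replace (alpha + (2 * INR K + 1) * h) with (alpha - h + 2 * INR m * PI) in Htel.
  - rewrite sin_period in Htel. nra.
  - unfold h. rewrite S_INR in *. field. lra.
Qed.

Fixpoint dirichlet (p : nat) (t : R) : R :=
  match p with
  | O => 1
  | S q => dirichlet q t + 2 * cos (INR p * t)
  end.

(* Not normalised: the mean value is [N]. *)
Fixpoint fejer (N : nat) (t : R) : R :=
  match N with
  | O => 0
  | S M => fejer M t + dirichlet M t
  end.

Lemma dirichlet_closed (p : nat) (t : R) :
  (1 - cos t) * dirichlet p t = cos (INR p * t) - cos (INR (S p) * t).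
Proof.
  induction p as [|p IH].
  - simpl. rewrite Rmult_0_l, cos_0, Rmult_1_l. ring.
  - change (dirichlet (S p) t) with (dirichlet p t + 2 * cos (INR (S p) * t)).
    rewrite Rmult_plus_distr_l, IH.
    replace (INR p * t) with (INR (S p) * t - t) by (rewrite S_INR; ring).
    replace (INR (S (S p)) * t) with (INR (S p) * t + t)
      by (rewrite (S_INR (S p)); ring).
    rewrite cos_plus, cos_minus. ring.
Qed.

(** The factor [1 - cos t] stays on the left, so the identity also holds where [cos t = 1]; the
    right side is visibly nonnegative. *)
Lemma fejer_closed (N : nat) (t : R) :
  (1 - cos t) * fejer N t = 1 - cos (INR N * t).
Proof.
  induction N as [|N IH].
  - simpl. rewrite Rmult_0_l, cos_0. ring.
  - change (fejer (S N) t) with (fejer N t + dirichlet N t).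
    rewrite Rmult_plus_distr_l, IH, dirichlet_closed. ring.
Qed.

Lemma fejer_nonneg (N : nat) (t : R) : 0 <= fejer N t.
Proof.
  destruct (COS_bound t) as [_ [Hlt | Heq]].
  - pose proof (fejer_closed N t). pose proof (COS_bound (INR N * t)). nra.
  (* Here the closed form only says [0 = 0]; but every cosine in the kernel equals 1, so the kernel
     is a sum of nonnegative terms. *)
  - assert (Hs : sin t = 0) by (pose proof (sin2_cos2 t); unfold Rsqr in *; nra).
    assert (Hc : forall p, cos (INR p * t) = 1).
    { induction p as [|p IH].
      - simpl. now rewrite Rmult_0_l, cos_0.
      - replace (INR (S p) * t) with (INR p * t + t) by (rewrite S_INR; ring).
        rewrite cos_plus, IH, Heq, Hs. ring. }
    assert (Hd : forall p, 0 <= dirichlet p t).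
    { induction p as [|p IH]; [simpl; lra|].
      change (0 <= dirichlet p t + 2 * cos (INR (S p) * t)). rewrite Hc. lra. }
    induction N as [|N IH]; simpl; [lra|]. specialize (Hd N). lra.
Qed.

(** Each new kernel term splits by product-to-sum into the frequencies [j + S p] and [j - S p]. The
    node sum kills every nonzero frequency below [S K] in absolute value, so only [j = S p] adds
    something; the bound on [j + p] excludes aliasing. *)
Lemma sum_dirichlet_node (K p j : nat) (theta : R) :
  (j + p < S K)%nat ->
  (sum_n (fun l => dirichlet p (node (S K) l)
                   * cos (INR j * (theta + node (S K) l))) K : R)
  = if Nat.leb j p then INR (S K) * cos (INR j * theta) else 0.
Proof.
  induction p as [|p IH]; intros Hp.
  - destruct j as [|j].
    + rewrite (sum_n_eq _ (fun _ => 1)).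
      * rewrite sum_n_const. simpl Nat.leb. simpl (INR 0).
        rewrite Rmult_0_l, cos_0. ring.
      * intros l. simpl. rewrite Rmult_0_l, cos_0. ring.
    + simpl Nat.leb.
      rewrite <- (sum_cos_node K (S j) (INR (S j) * theta)) by lia.
      apply sum_n_eq. intros l. simpl dirichlet.
      rewrite Rmult_1_l, Rmult_plus_distr_l. reflexivity.
  - rewrite (sum_n_eq _ (fun l =>
        dirichlet p (node (S K) l) * cos (INR j * (theta + node (S K) l))
        + (cos (INR j * theta + INR (j + S p) * node (S K) l)
           + cos (INR j * theta + (INR j - INR (S p)) * node (S K) l)))).
    2: { intros l.
         change (dirichlet (S p) (node (S K) l)) with
           (dirichlet p (node (S K) l) + 2 * cos (INR (S p) * node (S K) l)).
         rewrite plus_INR.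
         replace (INR j * theta + (INR j + INR (S p)) * node (S K) l)
           with (INR j * (theta + node (S K) l) + INR (S p) * node (S K) l)
           by ring.
         replace (INR j * theta + (INR j - INR (S p)) * node (S K) l)
           with (INR j * (theta + node (S K) l) - INR (S p) * node (S K) l)
           by ring.
         rewrite cos_plus, cos_minus. ring. }
    unfold sum_n. rewrite !sum_n_m_add. fold (sum_n (fun l =>
        dirichlet p (node (S K) l) * cos (INR j * (theta + node (S K) l))) K).
    rewrite IH by lia.
    pose proof (sum_cos_node K (j + S p) (INR j * theta)) as H1.
    unfold sum_n in H1. rewrite H1 by lia. clear H1.
    destruct (Nat.lt_trichotomy j (S p)) as [Hlt | [Heq | Hgt]].
    + replace (Nat.leb j p) with true by (symmetry; apply Nat.leb_le; lia).
      replace (Nat.leb j (S p)) with true by (symmetry; apply Nat.leb_le; lia).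
      (* The difference frequency is negative here; evenness of the cosine makes it the natural
         number [S p - j]. *)
      pose proof (sum_cos_node K (S p - j) (- (INR j * theta))) as H1.
      unfold sum_n in H1.
      rewrite (sum_n_m_eq_loc _ (fun l => cos (- (INR j * theta)
                                 + INR (S p - j) * node (S K) l))).
      * rewrite H1 by lia. ring.
      * intros l _. rewrite minus_INR by lia.
        rewrite <- (cos_neg (_ + _)). f_equal. ring.
    + subst j.
      replace (Nat.leb (S p) p) with false by (symmetry; apply Nat.leb_gt; lia).
      rewrite Nat.leb_refl.
      rewrite (sum_n_m_eq_loc _ (fun _ => cos (INR (S p) * theta))).
      * rewrite sum_n_m_const, Nat.sub_0_r. ring.
      * intros l _. f_equal. ring.
    + replace (Nat.leb j p) with false by (symmetry; apply Nat.leb_gt; lia).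
      replace (Nat.leb j (S p)) with false by (symmetry; apply Nat.leb_gt; lia).
      pose proof (sum_cos_node K (j - S p) (INR j * theta)) as H1.
      unfold sum_n in H1.
      rewrite minus_INR in H1 by lia. rewrite H1 by lia. ring.
Qed.

(** Of the Dirichlet kernels of order below [N], exactly [N - j] let frequency [j] pass. Truncated
    subtraction yields the multiplier 0 for all [j >= N]. *)
Lemma sum_fejer_node (K N j : nat) (theta : R) :
  (j + N <= S K)%nat ->
  (sum_n (fun l => fejer N (node (S K) l)
                   * cos (INR j * (theta + node (S K) l))) K : R)
  = INR (N - j) * (INR (S K) * cos (INR j * theta)).
Proof.
  induction N as [|N IH]; intros HN.
  - simpl (0 - j)%nat. simpl (INR 0). rewrite Rmult_0_l.
    apply sum_n_m_zero_loc. intros i _. simpl. ring.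
  - rewrite (sum_n_eq _ (fun l =>
        fejer N (node (S K) l) * cos (INR j * (theta + node (S K) l))
        + dirichlet N (node (S K) l) * cos (INR j * (theta + node (S K) l))))
      by (intros l; simpl; ring).
    unfold sum_n. rewrite sum_n_m_add.
    change (sum_n (fun l => fejer N (node (S K) l)
                  * cos (INR j * (theta + node (S K) l))) K
            + sum_n (fun l => dirichlet N (node (S K) l)
                  * cos (INR j * (theta + node (S K) l))) K
            = INR (S N - j) * (INR (S K) * cos (INR j * theta))).
    rewrite IH, sum_dirichlet_node by lia.
    destruct (Nat.leb_spec j N).
    + replace (S N - j)%nat with (S (N - j)) by lia. rewrite (S_INR (N - j)). ring.
    + replace (N - j)%nat with 0%nat by lia.
      replace (S N - j)%nat with 0%nat by lia. simpl (INR 0). ring.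
Qed.

(** The weighted sum is an average over the nodes of translates of the original sum, with the
    nonnegative kernel as weights, so its size is at most [B] times the mean weight [N]. *)
Lemma fejer_mean_bound (b : nat -> R) (P N : nat) (B : R) :
  (forall theta, Rabs (sum_n (fun j => b j * cos (INR j * theta)) P) <= B) ->
  forall theta,
    Rabs (sum_n (fun j => b j * INR (N - j) * cos (INR j * theta)) P)
    <= INR N * B.
Proof.
  intros HB theta.
  (* Enough nodes for [sum_fejer_node] to apply to every frequency [j <= P]. *)
  set (K := (P + N)%nat).
  assert (HL : 0 < INR (S K)) by (apply lt_0_INR; lia).
  apply Rmult_le_reg_l with (INR (S K)); auto.
  rewrite <- (Rabs_pos_eq (INR (S K))) at 1 by lra.
  rewrite <- Rabs_mult.
  assert (E : INR (S K) *
      sum_n (fun j => b j * INR (N - j) * cos (INR j * theta)) P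
    = sum_n (fun l => fejer N (node (S K) l)
         * sum_n (fun j => b j * cos (INR j * (theta + node (S K) l))) P) K).
  { unfold sum_n at 1. rewrite <- sum_n_m_Rmult_l.
    transitivity (sum_n (fun j => sum_n (fun l => b j * (fejer N (node (S K) l)
          * cos (INR j * (theta + node (S K) l)))) K) P).
    - apply sum_n_m_eq_loc. intros j Hj.
      unfold sum_n. rewrite sum_n_m_Rmult_l.
      pose proof (sum_fejer_node K N j theta) as H. unfold sum_n in H.
      rewrite H by lia. ring.
    - rewrite sum_n_switch. apply sum_n_eq. intros l.
      unfold sum_n. rewrite <- sum_n_m_Rmult_l.
      apply sum_n_m_eq_loc. intros j _. ring. }
  rewrite E.
  eapply Rle_trans; [apply sum_n_m_Rabs_le|].
  apply Rle_trans with (sum_n_m (fun l => B * fejer N (node (S K) l)) 0 K).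
  - apply sum_n_m_le. intros l. rewrite Rabs_mult.
    rewrite (Rabs_pos_eq (fejer _ _)) by apply fejer_nonneg.
    rewrite Rmult_comm. apply Rmult_le_compat_r; auto using fejer_nonneg.
  - rewrite sum_n_m_Rmult_l.
    (* The total weight is the case of frequency 0. *)
    assert (H0 : sum_n_m (fun l => fejer N (node (S K) l)) 0 K = INR N * INR (S K)).
    { pose proof (sum_fejer_node K N 0 0) as H.
      rewrite Nat.sub_0_r in H. simpl (INR 0) in H.
      rewrite Rmult_0_l, cos_0, Rmult_1_r in H. rewrite <- H by lia.
      apply sum_n_m_eq_loc. intros l _. rewrite Rmult_0_l, cos_0. ring. }
    rewrite H0. lra.
Qed.

(** * Cosine series convergent in the disk *)

Lemma cos_series_abs_summable (b : nat -> R) (u : C -> R) (r : R) :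
  is_cos_series_sum b u -> 0 <= r < 1 ->
  ex_series (fun j => Rabs (b j * r ^ j)).
Proof.
  intros Hu Hr.
  apply CV_disk_inside.
  set (s := (1 + r) / 2).
  assert (Hs : r < s < 1) by (unfold s; lra).
  apply Rbar_lt_le_trans with (Finite s).
  { simpl. rewrite Rabs_pos_eq; lra. }
  destruct (Rbar_le_lt_dec s (CV_radius b)) as [H | H]; auto.
  exfalso.
  (* At angle 0 the cosine series is the power series of [b]. Its convergence at [s] forces the
     terms to 0, which fails beyond the radius of convergence. *)
  apply (CV_disk_outside b s).
  { rewrite Rabs_pos_eq by lra. exact H. }
  apply ex_series_lim_0.
  exists (u (s * cos 0, s * sin 0)).
  eapply is_series_ext; [|apply (Hu s 0); lra].
  intros j. simpl. rewrite Rmult_0_r, cos_0. apply Rmult_1_r.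
Qed.

(** The point is that [P0] does not depend on [theta]: absolute summability bounds the tail after
    [P] by 1/2 uniformly, and pointwise convergence, at an index [T] that may depend on [theta],
    costs the other 1/2. *)
Lemma cos_series_partial_sum_bound (b : nat -> R) (u : C -> R) (r B : R) :
  is_cos_series_sum b u -> 0 <= r < 1 ->
  (forall theta, Rabs (u (r * cos theta, r * sin theta)) <= B) ->
  exists P0 : nat, forall P theta, (P0 <= P)%nat ->
    Rabs (sum_n (fun j => b j * r ^ j * cos (INR j * theta)) P) <= B + 1.
Proof.
  intros Hu Hr HB.
  assert (Hhalf : 0 < / 2) by lra.
  destruct (Cauchy_ex_series _ (cos_series_abs_summable b u r Hu Hr)
              (mkposreal _ Hhalf)) as [P0 HP0].
  exists P0. intros P theta HP.
  pose proof (proj2 (is_lim_seq_spec _ (Finite _)) (Hu r theta Hr)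
                (mkposreal _ Hhalf))
    as [Q HQ].
  set (f := fun j => b j * r ^ j * cos (INR j * theta)) in *.
  set (w := u (r * cos theta, r * sin theta)) in *.
  set (T := Nat.max (S P) Q).
  assert (HT : Rabs (sum_n f T - w) < / 2) by (apply HQ; unfold T; lia).
  assert (Htail : Rabs (sum_n_m f (S P) T) < / 2).
  { eapply Rle_lt_trans; [apply sum_n_m_Rabs_le|].
    assert (HS : Rabs (sum_n_m (fun j => Rabs (b j * r ^ j)) (S P) T) < / 2)
      by (apply (HP0 (S P) T); unfold T; lia).
    eapply Rle_lt_trans; [|eapply Rle_lt_trans; [apply Rle_abs|exact HS]].
    apply sum_n_m_le. intros j. unfold f. rewrite Rabs_mult.
    pose proof (COS_bound (INR j * theta)).
    pose proof (Rabs_pos (b j * r ^ j)).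
    assert (Rabs (cos (INR j * theta)) <= 1) by (apply Rabs_le; lra).
    nra. }
  assert (E : sum_n f T = sum_n f P + sum_n_m f (S P) T).
  { unfold sum_n. apply sum_n_m_Chasles_R; unfold T; lia. }
  replace (sum_n f P) with ((sum_n f T - w) + w - sum_n_m f (S P) T)
    by (rewrite E; ring).
  specialize (HB theta). fold w in HB.
  pose proof (Rabs_triang ((sum_n f T - w) + w) (- sum_n_m f (S P) T)).
  pose proof (Rabs_triang (sum_n f T - w) w).
  rewrite Rabs_Ropp in H. unfold Rminus at 1. lra.
Qed.

(** * Sums over the lacunary blocks *)

Lemma sum_n_m_last (f : nat -> R) (a b : nat) :
  (a <= b)%nat -> (forall j, (a <= j < b)%nat -> f j = 0) ->
  (sum_n_m f a b : R) = f b.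
Proof.
  intros Hab H0. destruct b as [|b].
  - replace a with 0%nat by lia. apply sum_n_n.
  - rewrite (sum_n_m_Chasles_R f a b (S b)) by lia.
    rewrite (sum_n_m_zero_loc f a b) by (intros; apply H0; lia).
    rewrite sum_n_n. apply Rplus_0_l.
Qed.

(** Induction on [M], cutting at [s M]: since [f] vanishes strictly between consecutive values of
    [s], each piece reduces to its last term. *)
Lemma sum_n_m_reindex (f : nat -> R) (s : nat -> nat) (a b M : nat) :
  (forall m, (s m < s (S m))%nat) -> (a <= s 0)%nat -> (s M <= b)%nat ->
  (forall j, (a <= j <= b)%nat -> (forall m, (m <= M)%nat -> j <> s m) ->
     f j = 0) ->
  (sum_n_m f a b : R) = sum_n (fun m => f (s m)) M.
Proof.
  intros Hs Ha. revert b.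
  assert (Hmono : forall p q, (p <= q)%nat -> (s p <= s q)%nat).
  { intros p q Hpq. induction Hpq as [|q _ IH]; auto.
    specialize (Hs q). lia. }
  assert (Hgap : forall M b, (s M <= b)%nat ->
     (forall j, (s M < j <= b)%nat -> f j = 0) ->
     sum_n_m f a b = sum_n_m f a (s M) :> R).
  { intros M' b Hb H0. specialize (Hmono 0%nat M' ltac:(lia)).
    rewrite (sum_n_m_Chasles_R f a (s M') b) by lia.
    rewrite (sum_n_m_zero_loc f (S (s M')) b) by (intros; apply H0; lia).
    apply Rplus_0_r. }
  assert (Hoff : forall M j, (s M < j)%nat ->
                  forall m, (m <= M)%nat -> j <> s m).
  { intros M' j Hj m Hm. specialize (Hmono m M' Hm). lia. }
  induction M as [|M IH]; intros b Hb H0.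
  - rewrite (Hgap 0%nat b Hb) by (intros; apply H0; [lia | apply Hoff; lia]).
    rewrite sum_O. apply sum_n_m_last; auto.
    intros j Hj. apply H0; [lia|]. intros m Hm. replace m with 0%nat by lia. lia.
  - pose proof (Hmono 0%nat M ltac:(lia)). pose proof (Hs M).
    rewrite (Hgap (S M) b Hb)
      by (intros; apply H0; [lia | apply Hoff; lia]).
    rewrite (sum_n_m_Chasles_R f a (s M) (s (S M))) by lia.
    rewrite sum_n_Sn, (IH (s M)).
    + f_equal. apply sum_n_m_last; [lia|]. intros j Hj. apply H0; [lia|].
      intros m Hm. destruct (Nat.eq_dec m (S M)) as [->|]; [lia|].
      apply (Hoff M); lia.
    + lia.
    + intros j Hj Hjm. apply H0; [lia|]. intros m Hm.
      destruct (Nat.eq_dec m (S M)) as [->|]; [lia|]. apply Hjm; lia.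
Qed.

(** This [M] is the integer part of log_4(x/2), the last exponent of a block. *)
Lemma exists_log4_half (x : nat) :
  (2 <= x)%nat -> exists M, (2 * 4 ^ M <= x < 2 * 4 ^ S M)%nat.
Proof.
  intros Hx.
  assert (H : forall B, (x < 2 * 4 ^ B)%nat ->
                exists M, (2 * 4 ^ M <= x < 2 * 4 ^ S M)%nat).
  { induction B as [|B IH]; intros HB; [simpl in HB; lia|].
    destruct (Nat.lt_ge_cases x (2 * 4 ^ B)); [auto|]. exists B. lia. }
  apply (H x). pose proof (Nat.pow_gt_lin_r 4 x). lia.
Qed.

Lemma ln4_pos : 0 < ln 4.
Proof. rewrite <- ln_1. apply ln_increasing; lra. Qed.

Lemma INR_double_pow4 (m : nat) : INR (2 * 4 ^ m) = 2 * 4 ^ m.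
Proof. rewrite mult_INR, pow_INR. now rewrite !INR_IZR_INZ. Qed.

Lemma le_Rlog4_half (x m : nat) :
  (2 <= x)%nat ->
  INR m <= Rlog 4 (INR x / 2) <-> (2 * 4 ^ m <= x)%nat.
Proof.
  intros Hx.
  pose proof ln4_pos as Hl4.
  assert (Hx0 : 2 <= INR x) by (apply (le_INR 2); lia).
  assert (H4m : 0 < 4 ^ m) by (apply pow_lt; lra).
  assert (E : INR m <= Rlog 4 (INR x / 2) <-> ln (4 ^ m) <= ln (INR x / 2)).
  { rewrite ln_pow by lra. unfold Rlog. split; intros H.
    - apply Rmult_le_compat_r with (r := ln 4) in H; [|lra].
      unfold Rdiv at 1 in H. rewrite Rmult_assoc, Rinv_l, Rmult_1_r in H; lra.
    - apply Rmult_le_reg_r with (ln 4); [lra|].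
      unfold Rdiv at 1. rewrite Rmult_assoc, Rinv_l, Rmult_1_r; lra. }
  rewrite E. split; intros H.
  - apply INR_le. rewrite INR_double_pow4.
    apply Rnot_lt_le. intros Hlt.
    assert (ln (INR x / 2) < ln (4 ^ m)) by (apply ln_increasing; lra). lra.
  - apply le_INR in H. rewrite INR_double_pow4 in H.
    apply ln_le; lra.
Qed.

Lemma quadrupling_le (n : nat -> nat) :
  (forall k, (1 <= k)%nat -> (4 * n (k - 1) <= n k)%nat) ->
  forall k l, (k <= l)%nat -> (n k <= n l)%nat.
Proof.
  intros Hn k l Hkl. induction Hkl as [|l _ IH]; auto.
  specialize (Hn (S l) ltac:(lia)). rewrite Nat.sub_succ, Nat.sub_0_r in Hn. lia.
Qed.

Lemma quadrupling_ge (n : nat -> nat) :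
  n 0%nat = 2%nat ->
  (forall k, (1 <= k)%nat -> (4 * n (k - 1) <= n k)%nat) ->
  forall k, (2 * 4 ^ k <= n k)%nat.
Proof.
  intros H0 Hn. induction k as [|k IH]; [simpl; lia|].
  specialize (Hn (S k) ltac:(lia)). rewrite Nat.sub_succ, Nat.sub_0_r in Hn.
  rewrite Nat.pow_succ_r'. lia.
Qed.

(** Quadrupling keeps the frequencies of block [k] in the interval from [n (k - 1) + 1] to [n k],
    and these intervals are disjoint. Allowing any [f] that vanishes with [a] covers squares,
    absolute values and terms of the cosine series alike. *)
Lemma block_sum (v : R -> R) (n : nat -> nat) (nu a : nat -> R) (k : nat) :
  n 0%nat = 2%nat ->
  (forall i, (1 <= i)%nat -> (4 * n (i - 1) <= n i)%nat) ->
  is_block_coeffs v n nu a -> (1 <= k)%nat ->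
  exists M : nat,
    (2 * 4 ^ M <= n k < 2 * 4 ^ S M)%nat /\
    (forall m, (m <= M)%nat ->
       a (n (k - 1) + 4 ^ m)%nat
       = nu k * (weight_g v (INR (n k)) / ln (INR (n k)))) /\
    (forall f : nat -> R, (forall j, a j = 0 -> f j = 0) ->
       (sum_n_m f (S (n (k - 1)%nat)) (n k) : R)
       = sum_n (fun m => f (n (k - 1) + 4 ^ m)%nat) M).
Proof.
  intros H0 Hn [Ha Ha0] Hk.
  pose proof (quadrupling_le n Hn) as Hmono.
  assert (Hge2 : forall i, (2 <= n i)%nat)
    by (intros i; rewrite <- H0; apply Hmono; lia).
  destruct (exists_log4_half (n k) (Hge2 k)) as [M HM].
  assert (Hpow : forall p q, (p <= q)%nat -> (4 ^ p <= 4 ^ q)%nat)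
    by (intros; apply Nat.pow_le_mono_r; lia).
  (* The upper bound holds because [n (i - 1)] is at most a quarter and [4 ^ m] at most half of
     [n i]. *)
  assert (Hin : forall i m, (1 <= i)%nat -> (2 * 4 ^ m <= n i)%nat ->
                  (n (i - 1) < n (i - 1) + 4 ^ m <= n i)%nat).
  { intros i m Hi Hm. specialize (Hn i Hi).
    pose proof (Hpow 0%nat m ltac:(lia)). simpl in H. lia. }
  exists M. split; [exact HM|]. split.
  - intros m Hm. apply (Ha k m). split; [exact Hk|]. split; [|reflexivity].
    apply le_Rlog4_half; auto. specialize (Hpow m M Hm). lia.
  - intros f Hf.
    apply (sum_n_m_reindex f (fun m => (n (k - 1) + 4 ^ m)%nat)).
    + intros m. pose proof (Nat.pow_lt_mono_r 4 m (S m)). lia.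
    + simpl. lia.
    + apply Hin; lia.
    + intros j Hj Hjm. apply Hf, Ha0. intros (i & m & Hi & Hm & Ej).
      apply le_Rlog4_half in Hm; auto.
      pose proof (Hin i m Hi Hm) as Hi'.
      assert (i = k).
      { destruct (Nat.lt_trichotomy i k) as [Hlt | [Heq | Hgt]]; auto; exfalso.
        - pose proof (Hmono i (k - 1)%nat ltac:(lia)). lia.
        - pose proof (Hmono k (i - 1)%nat ltac:(lia)). lia. }
      subst i. apply (Hjm m); auto.
      destruct (Nat.le_gt_cases m M) as [|Hlt]; auto.
      specialize (Hpow (S M) m ltac:(lia)). lia.
Qed.

Lemma ln4_eq : ln 4 = 2 * ln 2.
Proof. replace 4 with (2 * 2) by ring. rewrite ln_mult by lra. ring. Qed.

(** From [2 * 4 ^ M <= x] one gets (M + 1) ln 4 <= ln x + ln 2, and [8 <= x] makes ln 2 at most a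
    third of ln x; hence the factor 4/3. *)
Lemma block_length_le (x M : nat) :
  (8 <= x)%nat -> (2 * 4 ^ M <= x)%nat ->
  INR (S M) <= 4 / (3 * ln 4) * ln (INR x).
Proof.
  intros H8 HM. pose proof ln4_pos as H4. pose proof ln4_eq as H42.
  apply le_INR in HM. rewrite INR_double_pow4 in HM.
  apply le_INR in H8. rewrite (INR_IZR_INZ 8) in H8. simpl in H8.
  assert (Hp : 0 < 4 ^ M) by (apply pow_lt; lra).
  assert (HlM : ln 2 + INR M * ln 4 <= ln (INR x)).
  { rewrite <- ln_pow, <- ln_mult by lra. apply ln_le; lra. }
  assert (Hl8 : 3 * ln 2 <= ln (INR x)).
  { replace (3 * ln 2) with (ln 8); [apply ln_le; lra|].
    replace 8 with (2 * 4) by ring. rewrite ln_mult by lra. lra. }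
  rewrite S_INR.
  replace (4 / (3 * ln 4) * ln (INR x)) with (4 / 3 * ln (INR x) / ln 4)
    by (field; lra).
  apply Rmult_le_reg_r with (ln 4); [lra|].
  unfold Rdiv at 1. rewrite Rmult_assoc, Rinv_l by lra. lra.
Qed.

(** The loss 3/2 is 1 for the step from [S M] to [M] plus ln 2 / ln 4 = 1/2. *)
Lemma block_length_ge (x M : nat) :
  (1 <= x)%nat -> (x < 2 * 4 ^ S M)%nat ->
  ln (INR x) / ln 4 - 3 / 2 <= INR M.
Proof.
  intros H1 HM. pose proof ln4_pos as H4. pose proof ln4_eq as H42.
  apply Nat.lt_le_incl, le_INR in HM. rewrite INR_double_pow4 in HM.
  apply (le_INR 1) in H1. simpl in H1.
  assert (Hp : 0 < 4 ^ S M) by (apply pow_lt; lra).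
  assert (HlM : ln (INR x) <= ln 2 + INR (S M) * ln 4).
  { rewrite <- ln_pow, <- ln_mult by lra. apply ln_le; lra. }
  rewrite S_INR in HlM.
  apply Rmult_le_reg_r with (ln 4); [lra|].
  replace ((ln (INR x) / ln 4 - 3 / 2) * ln 4) with (ln (INR x) - 3 / 2 * ln 4)
    by (field; lra).
  lra.
Qed.

(** * Growth estimates *)

Lemma weight_g_double (v : R -> R) (D x : R) :
  (forall t, 0 < t <= 1 / 2 -> v (1 - t) <= D * v (1 - 2 * t)) ->
  1 <= x -> weight_g v (2 * x) <= D * weight_g v x.
Proof.
  intros HD Hx. unfold weight_g.
  specialize (HD (1 / (2 * x))).
  replace (1 - 2 * (1 / (2 * x))) with (1 - 1 / x) in HD by (field; lra).
  apply HD. split.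
  - apply Rdiv_lt_0_compat; lra.
  - apply Rmult_le_reg_r with (2 * x); [lra|].
    unfold Rdiv at 1. rewrite Rmult_assoc, Rinv_l by lra. lra.
Qed.

Lemma weight_g_ge_1 (v : R -> R) (x : R) :
  is_weight v -> 1 <= x -> 1 <= weight_g v x.
Proof.
  intros (_ & Hinc & _ & H0 & _) Hx. unfold weight_g.
  assert (0 < / x <= 1).
  { split; [apply Rinv_0_lt_compat; lra|].
    rewrite <- Rinv_1. apply Rinv_le_contravar; lra. }
  apply Rle_trans with (v 0); [lra|].
  apply Hinc; unfold Rdiv; lra.
Qed.

(** The left side is the value of [weight_g v] at [16 * x], four doublings away from [x]; hence the
    constant D^4. *)
Lemma weight_near_boundary (v : R -> R) :
  is_weight v ->
  exists E : R, 0 < E /\ forall x, 1 <= x ->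
    v (1 - 1 / (16 * x)) <= E * weight_g v x.
Proof.
  intros (Hpos & _ & _ & _ & _ & D & HD).
  assert (HD0 : 0 < D).
  { specialize (HD (1 / 2) ltac:(lra)).
    pose proof (Hpos (1 - 1 / 2) ltac:(lra)).
    pose proof (Hpos (1 - 2 * (1 / 2)) ltac:(lra)).
    apply Rnot_le_lt. intros Hle. nra. }
  exists (D * (D * (D * D))). split.
  { repeat apply Rmult_lt_0_compat; assumption. }
  intros x Hx. change (weight_g v (16 * x) <= D * (D * (D * D)) * weight_g v x).
  replace (16 * x) with (2 * (2 * (2 * (2 * x)))) by ring.
  assert (Hstep : forall y e, 1 <= y -> weight_g v y <= e ->
                    weight_g v (2 * y) <= D * e).
  { intros y e Hy He. eapply Rle_trans; [apply weight_g_double; eauto|].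
    apply Rmult_le_compat_l; lra. }
  rewrite !Rmult_assoc.
  apply Hstep; [lra|]. apply Hstep; [lra|]. apply Hstep; [lra|].
  apply Hstep; lra.
Qed.

Lemma pow_unit_interval (x : R) (j : nat) : 0 <= x <= 1 -> 0 <= x ^ j <= 1.
Proof. intros Hx. induction j as [|j IH]; simpl; nra. Qed.

(** Bernoulli's inequality. *)
Lemma one_minus_pow_ge (x : R) (j : nat) :
  0 <= x <= 1 -> 1 - INR j * x <= (1 - x) ^ j.
Proof.
  intros Hx. induction j as [|j IH].
  - simpl. lra.
  - rewrite S_INR. simpl.
    pose proof (pow_unit_interval (1 - x) j ltac:(lra)). nra.
Qed.

(** Put q = 4/(3 ln 4) and let G_k be [nu k] times the weight at [n k]. Block k adds at most q G_k,
    and A G_k <= G_{k+1}. The factor q/(A - 1) reproduces itself in the induction because q/(A - 1)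
    + q = A q/(A - 1). *)
Lemma sum_abs_coeffs_le (v : R -> R) (A : R) (n : nat -> nat)
    (nu a : nat -> R) :
  is_weight v -> 1 < A -> is_growth_sequence v A n ->
  (forall k, (1 <= k)%nat -> (4 * n (k - 1) <= n k)%nat) ->
  (forall k, (1 <= k)%nat -> 0 < nu k) ->
  (forall k, (1 <= k)%nat -> nu k <= nu (S k)) ->
  is_block_coeffs v n nu a ->
  forall k, sum_n (fun j => Rabs (a j)) (n k)
    <= 4 / (3 * ln 4) / (A - 1) * (nu (S k) * weight_g v (INR (n (S k)))).
Proof.
  intros Hv HA [H0 Hg] Hn Hnu Hinc Ha.
  pose proof ln4_pos as H4.
  set (q := 4 / (3 * ln 4)).
  assert (Hq : 0 < q) by (apply Rdiv_lt_0_compat; lra).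
  pose proof (quadrupling_ge n H0 Hn) as Hge.
  assert (Hg1 : forall k, 1 <= weight_g v (INR (n k))).
  { intros k. apply weight_g_ge_1; auto. apply (le_INR 1).
    specialize (Hge k). pose proof (Nat.pow_nonzero 4 k). lia. }
  induction k as [|k IH].
  (* Every block lies beyond [n 0], so no coefficient is nonzero yet. *)
  - apply Rle_trans with 0.
    + apply Req_le. unfold sum_n. apply sum_n_m_zero_loc. intros j Hj.
      destruct Ha as [_ Ha]. rewrite Ha; [apply Rabs_R0|].
      intros (i & m & Hi & _ & Ej).
      pose proof (quadrupling_le n Hn 0 (i - 1) ltac:(lia)).
      pose proof (Nat.pow_nonzero 4 m). lia.
    + apply Rmult_le_pos.
      * apply Rlt_le, Rdiv_lt_0_compat; lra.
      * specialize (Hnu 1%nat ltac:(lia)). specialize (Hg1 1%nat). nra.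
  - destruct (block_sum v n nu a (S k) H0 Hn Ha ltac:(lia))
      as (M & HM & HaM & Hsum).
    rewrite Nat.sub_succ, Nat.sub_0_r in *.
    pose proof (Hn (S k) ltac:(lia)) as Hnk.
    rewrite Nat.sub_succ, Nat.sub_0_r in Hnk.
    assert (H8 : (8 <= n (S k))%nat).
    { specialize (Hge (S k)). pose proof (Nat.pow_nonzero 4 k).
      rewrite Nat.pow_succ_r' in Hge. lia. }
    assert (Hl : 0 < ln (INR (n (S k)))).
    { rewrite <- ln_1. apply ln_increasing; [lra|]. apply (lt_INR 1). lia. }
    unfold sum_n. rewrite (sum_n_m_Chasles_R _ 0 (n k)) by lia.
    rewrite (Hsum (fun j => Rabs (a j))) by (intros j ->; apply Rabs_R0).
    fold (sum_n (fun j => Rabs (a j)) (n k)).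
    set (G := nu (S k) * weight_g v (INR (n (S k)))) in *.
    assert (HG : 0 < G).
    { unfold G. specialize (Hnu (S k) ltac:(lia)). specialize (Hg1 (S k)).
      apply Rmult_lt_0_compat; lra. }
    assert (HB : sum_n (fun m => Rabs (a (n k + 4 ^ m)%nat)) M <= q * G).
    { unfold sum_n.
      rewrite (sum_n_m_eq_loc _ (fun _ => G / ln (INR (n (S k))))).
      - rewrite sum_n_m_const, Nat.sub_0_r.
        pose proof (block_length_le _ M H8 (proj1 HM)) as HL. fold q in HL.
        replace (q * G)
          with (q * ln (INR (n (S k))) * (G / ln (INR (n (S k)))))
          by (field; lra).
        apply Rmult_le_compat_r; auto.
        apply Rlt_le, Rdiv_lt_0_compat; lra.
      - intros m Hm. rewrite HaM by lia. unfold G, Rdiv.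
        rewrite Rabs_pos_eq; [ring|].
        apply Rlt_le. rewrite <- Rmult_assoc.
        apply Rmult_lt_0_compat; [exact HG|]. now apply Rinv_0_lt_compat. }
    destruct (Hg (S k)) as [[_ HAg] _].
    assert (HAG : A * G <= nu (S (S k)) * weight_g v (INR (n (S (S k))))).
    { unfold G. specialize (Hinc (S k) ltac:(lia)).
      specialize (Hnu (S k) ltac:(lia)).
      pose proof (Hg1 (S (S k))). apply Rge_le in HAg.
      apply Rle_trans with (nu (S k) * weight_g v (INR (n (S (S k))))); nra. }
    assert (Hqa : 0 < q / (A - 1)) by (apply Rdiv_lt_0_compat; lra).
    apply Rle_trans with (q / (A - 1) * (A * G)).
    + replace (q / (A - 1) * (A * G)) with (q / (A - 1) * G + q * G)
        by (field; lra).
      lra.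
    + apply Rmult_le_compat_l; lra.
Qed.

(** * Lower bound from a single block *)

Lemma sup_norm_le (f : R -> R) (B : R) :
  (forall theta, Rabs (f theta) <= B) -> Rbar_le (sup_norm f) B.
Proof.
  intros H. apply (proj2 (Lub_Rbar_correct _)).
  intros y [theta ->]. apply H.
Qed.

(* The [n k]-th Fejér mean of [u] on the circle of radius [r] contains only the
   frequencies of the first [k] blocks, and its weights are at least 1/4 on the
   [k]-th block, whose frequencies are at most [3/4 * n k]. *)
Lemma block_sum_le_growth (v : R -> R) (c B : R) (n : nat -> nat)
    (nu a xi : nat -> R) (u : C -> R) (k : nat) :
  is_weight v -> 0 < c -> cosine_lower_bound c ->
  n 0%nat = 2%nat ->
  (forall i, (1 <= i)%nat -> (4 * n (i - 1) <= n i)%nat) ->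
  0 < nu k -> is_block_coeffs v n nu a -> (1 <= k)%nat ->
  (forall j, xi j = 1 \/ xi j = -1) ->
  is_cos_series_sum (fun j => a j * xi j) u ->
  let r := 1 - 1 / (16 * INR (n k)) in
  (forall theta, Rabs (u (r * cos theta, r * sin theta)) <= B) ->
  let h := nu k * (weight_g v (INR (n k)) / ln (INR (n k))) in
  c * ((ln (INR (n k)) / ln 4 - 3 / 2) * (9 / 40 * h))
  <= B + 1 + h + sum_n (fun j => Rabs (a j)) (n (k - 1)%nat).
Proof.
  intros Hv Hc Hlow H0 Hn Hnu Ha Hk Hxi Hu r HB h.
  destruct (block_sum v n nu a k H0 Hn Ha Hk) as (M & HM & HaM & Hsum).
  fold h in HaM.
  pose proof (quadrupling_ge n H0 Hn k) as Hge.
  assert (Hnk := Hn k Hk).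
  assert (H2 : (2 <= n k)%nat) by (pose proof (Nat.pow_nonzero 4 k); lia).
  set (N := n k) in *. set (p := n (k - 1)%nat) in *.
  assert (HN : 2 <= INR N) by (apply (le_INR 2); lia).
  assert (Hlpos : 0 < ln (INR N)) by (rewrite <- ln_1; apply ln_increasing; lra).
  assert (Hh : 0 < h).
  { unfold h. apply Rmult_lt_0_compat; auto. apply Rdiv_lt_0_compat; auto.
    pose proof (weight_g_ge_1 v (INR N) Hv). lra. }
  assert (Hx : 0 < 1 / (16 * INR N) <= 1 / 32).
  { split; [apply Rdiv_lt_0_compat; lra|].
    unfold Rdiv. rewrite !Rmult_1_l. apply Rinv_le_contravar; lra. }
  assert (Hr : 0 <= r < 1) by (unfold r; lra).
  assert (Hrj : forall j, 0 <= r ^ j <= 1).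
  { intros j. apply pow_unit_interval. lra. }
  (* Bernoulli's inequality gives even 15/16, since [j <= N] and the circle has distance 1/(16 N)
     from the boundary. *)
  assert (Hrj9 : forall j, (j <= N)%nat -> 9 / 10 <= r ^ j).
  { intros j Hj. apply le_INR in Hj.
    pose proof (one_minus_pow_ge (1 / (16 * INR N)) j ltac:(lra)) as Hb.
    fold r in Hb.
    assert (INR j * (1 / (16 * INR N)) <= INR N * (1 / (16 * INR N)))
      by (apply Rmult_le_compat_r; lra).
    replace (INR N * (1 / (16 * INR N))) with (1 / 16) in H by (field; lra).
    lra. }
  assert (Hxi1 : forall j, Rabs (xi j) = 1).
  { intros j. destruct (Hxi j) as [-> | ->]; [apply Rabs_R1|].
    rewrite Rabs_left; lra. }
  set (w := fun j => a j * xi j * r ^ j * INR (N - j)).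
  assert (Hw : forall j, Rabs (w j) = Rabs (a j) * (r ^ j * INR (N - j))).
  { intros j. unfold w. rewrite !Rabs_mult, Hxi1.
    rewrite (Rabs_pos_eq (r ^ j)) by apply Hrj.
    rewrite (Rabs_pos_eq (INR _)) by apply pos_INR. ring. }
  assert (Hwle : forall j, Rabs (w j) <= INR N * Rabs (a j)).
  { intros j. rewrite Hw. rewrite Rmult_comm.
    apply Rmult_le_compat_r; [apply Rabs_pos|].
    assert (INR (N - j) <= INR N) by (apply le_INR; lia).
    pose proof (pos_INR (N - j)). specialize (Hrj j). nra. }
  destruct (cos_series_partial_sum_bound _ u r B Hu Hr HB) as [P0 HP0].
  set (P := Nat.max P0 N).
  assert (HF : forall theta,
    Rabs (sum_n (fun j => w j * cos (INR j * theta)) P) <= INR N * (B + 1)).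
  { apply (fejer_mean_bound (fun j => a j * xi j * r ^ j)).
    intros theta. apply HP0. unfold P. lia. }
  set (cs := fun m => w (p + 4 ^ m)%nat).
  set (S0 := sum_n (fun j => Rabs (a j)) p).
  assert (HT : forall theta,
    Rabs (sum_n_m (fun m => cs m * cos (INR (p + 4 ^ m) * theta)) 1 M)
    <= INR N * (B + 1 + h + S0)).
  { intros theta. specialize (HF theta).
    set (f := fun j => w j * cos (INR j * theta)) in *.
    assert (Hf : forall j, Rabs (f j) <= INR N * Rabs (a j)).
    { intros j. unfold f. rewrite Rabs_mult.
      pose proof (COS_bound (INR j * theta)).
      assert (Rabs (cos (INR j * theta)) <= 1) by (apply Rabs_le; lra).
      specialize (Hwle j). pose proof (Rabs_pos (w j)). nra. }
    (* The pieces are the earlier blocks, the exponent 0 and the exponents from 1 on. The exponent 0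
       is set apart because the sums in [cosine_lower_bound] start at 1; frequencies above [N] have
       Fejér weight 0. *)
    assert (E : (sum_n f P : R) = sum_n f p + (f (p + 4 ^ 0)%nat
                + sum_n_m (fun m => f (p + 4 ^ m)%nat) 1 M)).
    { unfold sum_n. rewrite (sum_n_m_Chasles_R f 0 p P) by (unfold P; lia).
      rewrite (sum_n_m_Chasles_R f (S p) N P) by (unfold P; lia).
      rewrite (sum_n_m_zero_loc f (S N) P).
      - rewrite Hsum.
        + unfold sum_n. rewrite (sum_n_m_Chasles_R _ 0 0 M) by lia.
          rewrite sum_n_n. ring.
        + intros j Hj. unfold f, w. rewrite Hj. ring.
      - intros j Hj. unfold f, w. replace (N - j)%nat with 0%nat by lia.
        simpl (INR 0). ring. }
    assert (Hlow1 : Rabs (sum_n f p) <= INR N * S0).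
    { eapply Rle_trans; [apply sum_n_m_Rabs_le|].
      unfold S0, sum_n. rewrite <- sum_n_m_Rmult_l. apply sum_n_m_le, Hf. }
    assert (Hlow2 : Rabs (f (p + 4 ^ 0)%nat) <= INR N * h).
    { eapply Rle_trans; [apply Hf|]. rewrite HaM by lia.
      rewrite Rabs_pos_eq; lra. }
    change (fun m => cs m * cos (INR (p + 4 ^ m) * theta))
      with (fun m => f (p + 4 ^ m)%nat).
    replace (sum_n_m (fun m => f (p + 4 ^ m)%nat) 1 M)
      with (sum_n f P + (- sum_n f p + - f (p + 4 ^ 0)%nat)) by (rewrite E; ring).
    pose proof (Rabs_triang (sum_n f P) (- sum_n f p + - f (p + 4 ^ 0)%nat)).
    pose proof (Rabs_triang (- sum_n f p) (- f (p + 4 ^ 0)%nat)).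
    rewrite !Rabs_Ropp in *. lra. }
  assert (Hc1 : c * sum_n_m (fun m => Rabs (cs m)) 1 M
                <= INR N * (B + 1 + h + S0)).
  { exact (Rbar_le_trans _ _ (Finite _) (Hlow p M cs) (sup_norm_le _ _ HT)). }
  (* 9/40 is the product of the Fejér weight 1/4 and the radial factor 9/10. *)
  assert (Hc2 : INR M * (INR N * (9 / 40 * h))
                <= sum_n_m (fun m => Rabs (cs m)) 1 M).
  { replace (INR M) with (INR (S M - 1)) by (f_equal; lia).
    rewrite <- sum_n_m_const. apply sum_n_m_le_loc. intros m Hm.
    unfold cs. rewrite Hw, HaM by lia. rewrite (Rabs_pos_eq h) by lra.
    assert (Hpm : (4 ^ m <= 4 ^ M)%nat) by (apply Nat.pow_le_mono_r; lia).
    assert (Hj : (4 * (p + 4 ^ m) <= 3 * N)%nat) by lia.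
    pose proof (Hrj9 (p + 4 ^ m)%nat ltac:(lia)) as H9.
    assert (HNj : INR N / 4 <= INR (N - (p + 4 ^ m))).
    { rewrite minus_INR by lia. apply le_INR in Hj.
      rewrite (mult_INR 4), (mult_INR 3) in Hj. simpl (INR 4) in Hj.
      simpl (INR 3) in Hj. lra. }
    assert (INR N / 4 * (9 / 10)
            <= r ^ (p + 4 ^ m) * INR (N - (p + 4 ^ m))) by nra.
    nra. }
  apply Rmult_le_reg_l with (INR N); [lra|].
  eapply Rle_trans; [|exact Hc1].
  replace (INR N * (c * ((ln (INR N) / ln 4 - 3 / 2) * (9 / 40 * h))))
    with (c * ((ln (INR N) / ln 4 - 3 / 2) * (INR N * (9 / 40 * h)))) by ring.
  apply Rmult_le_compat_l; [lra|].
  eapply Rle_trans; [|exact Hc2].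
  apply Rmult_le_compat_r; [nra|].
  apply block_length_ge; [lia|]. apply HM.
Qed.

(** * The square-sum bound, and unboundedness for every choice of signs *)

Theorem proposition4p1 :
  forall (v : R -> R) (c A : R) (n : nat -> nat) (nu a : nat -> R),
    is_weight v ->
    0 < c -> cosine_lower_bound c ->
    1 < A -> 1 / (A - 1) <= c / 8 ->
    is_growth_sequence v A n ->
    (forall k : nat, (1 <= k)%nat -> (4 * n (k - 1) <= n k)%nat) ->
    (forall k : nat, (1 <= k)%nat -> 0 < nu k) ->
    (forall k : nat, (1 <= k)%nat -> nu k <= nu (S k)) ->
    is_lim_seq nu p_infty ->
    is_block_coeffs v n nu a ->
    (exists K : R, forall k : nat, (1 <= k)%nat ->
       sqrt (sum_n_m (fun j => a j ^ 2) (S (n (k - 1)%nat)) (n k))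
         <= K * (nu k * (weight_g v (INR (n k)) / sqrt (ln (INR (n k)))))) /\
    (forall xi : nat -> R,
       (forall j : nat, xi j = 1 \/ xi j = -1) ->
       ~ exists u : C -> R,
           is_cos_series_sum (fun j => a j * xi j) u /\ h_infty v u).
Proof.
  intros v c A n nu a Hv Hc Hlow HA HAc Hgrow Hn Hnu Hinc Hlim Ha.
  pose proof ln4_pos as H4.
  set (q := 4 / (3 * ln 4)).
  assert (Hq : 0 < q) by (apply Rdiv_lt_0_compat; lra).
  pose proof (proj1 Hgrow) as H0.
  pose proof (quadrupling_ge n H0 Hn) as Hge.
  assert (Hge2 : forall k, 2 * 4 ^ k <= INR (n k)).
  { intros k. rewrite <- INR_double_pow4. apply le_INR, Hge. }
  assert (Hn1 : forall k, 1 < INR (n k)).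
  { intros k. specialize (Hge2 k). pose proof (pow_R1_Rle 4 k). lra. }
  assert (Hl : forall k, 0 < ln (INR (n k))).
  { intros k. rewrite <- ln_1. apply ln_increasing; [lra|apply Hn1]. }
  assert (Hg1 : forall k, 1 <= weight_g v (INR (n k))).
  { intros k. apply weight_g_ge_1; auto. apply Rlt_le, Hn1. }
  split.
  (* The block has at most q ln(n_k) nonzero terms, all equal, so the square root of their number
     supplies both [sqrt q] and the improved power of the logarithm. *)
  - exists (sqrt q). intros k Hk.
    destruct (block_sum v n nu a k H0 Hn Ha Hk) as (M & HM & HaM & Hsum).
    rewrite (Hsum (fun j => a j ^ 2)) by (intros j ->; ring).
    set (l := ln (INR (n k))) in *. set (g := weight_g v (INR (n k))) in *.
    assert (Hlk : 0 < l) by apply Hl.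
    assert (Hs : 0 < sqrt l) by (now apply sqrt_lt_R0).
    assert (Hs2 : sqrt l * sqrt l = l) by (apply sqrt_sqrt; lra).
    assert (Hgk : 1 <= g) by apply Hg1.
    specialize (Hnu k Hk).
    assert (Hx : 0 <= nu k * (g / sqrt l)).
    { apply Rlt_le, Rmult_lt_0_compat; auto. apply Rdiv_lt_0_compat; lra. }
    rewrite <- (sqrt_square (nu k * (g / sqrt l))) by exact Hx.
    rewrite <- sqrt_mult by nra.
    apply sqrt_le_1_alt.
    unfold sum_n. rewrite (sum_n_m_eq_loc _ (fun _ => (nu k * (g / l)) ^ 2))
      by (intros m Hm; now rewrite HaM by lia).
    rewrite sum_n_m_const, Nat.sub_0_r.
    replace (q * (nu k * (g / sqrt l) * (nu k * (g / sqrt l))))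
      with (q * l * (nu k * (g / l)) ^ 2).
    + apply Rmult_le_compat_r; [apply pow2_ge_0|].
      apply block_length_le; [|apply HM].
      pose proof (quadrupling_le n Hn 1 k Hk). specialize (Hge 1%nat).
      simpl in Hge. lia.
    + transitivity (q * (sqrt l * sqrt l) * (nu k * (g / (sqrt l * sqrt l))) ^ 2).
      * now rewrite Hs2.
      * field. lra.
  - intros xi Hxi (u & Hu & _ & K & HK & Hbound).
    destruct (weight_near_boundary v Hv) as (E & HE & HEv).
    (* The earlier blocks cost q c/8 = c/(6 ln 4), and 9/40 - 1/6 = 7/120 remains: the bound on 1/(A
       - 1) leaves a positive margin. The term 27/80 is 3/2 times 9/40. *)
    assert (Hkey : forall k, (1 <= k)%nat ->
      nu k * (c * (7 / 120 * (ln (INR (n k)) / ln 4)) - 1 - 27 / 80 * c)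
      <= (K * E + 1) * ln (INR (n k))).
    { intros k Hk.
      set (r := 1 - 1 / (16 * INR (n k))).
      set (l := ln (INR (n k))). set (g := weight_g v (INR (n k))).
      assert (Hlk : 0 < l) by apply Hl.
      assert (Hgk : 1 <= g) by apply Hg1.
      pose proof (Hnu k Hk) as Hnuk. specialize (Hn1 k).
      assert (Hr : 0 <= r < 1).
      { unfold r. assert (0 < 1 / (16 * INR (n k)) <= 1 / 16).
        { split; [apply Rdiv_lt_0_compat; lra|].
          unfold Rdiv. rewrite !Rmult_1_l. apply Rinv_le_contravar; lra. }
        lra. }
      assert (Hur : forall theta,
        Rabs (u (r * cos theta, r * sin theta)) <= K * (E * g)).
      { intros theta.
        assert (Hmod : Cmod (r * cos theta, r * sin theta) = r).
        { unfold Cmod. simpl fst. simpl snd.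
          replace ((r * cos theta) ^ 2 + (r * sin theta) ^ 2) with (r * r).
          - apply sqrt_square. lra.
          - transitivity (r * r * (Rsqr (sin theta) + Rsqr (cos theta))).
            + rewrite sin2_cos2. ring.
            + unfold Rsqr. ring. }
        specialize (Hbound (r * cos theta, r * sin theta)).
        unfold in_disk in Hbound. rewrite Hmod in Hbound.
        eapply Rle_trans; [apply Hbound; lra|].
        apply Rmult_le_compat_l; [lra|]. apply HEv. lra. }
      pose proof (block_sum_le_growth v c (K * (E * g)) n nu a xi u k Hv Hc Hlow
        H0 Hn Hnuk Ha Hk Hxi Hu Hur) as Hmain.
      cbv zeta in Hmain. fold l g in Hmain.
      pose proof (sum_abs_coeffs_le v A n nu a Hv HA Hgrow Hn Hnu Hinc Ha
        (k - 1)%nat) as Hsmall.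
      replace (S (k - 1)) with k in Hsmall by lia. fold g q in Hsmall.
      assert (Hsmall' : sum_n (fun j => Rabs (a j)) (n (k - 1)%nat)
                        <= q * (c / 8) * (nu k * g)).
      { eapply Rle_trans; [exact Hsmall|].
        apply Rmult_le_compat_r; [nra|].
        replace (q / (A - 1)) with (q * (1 / (A - 1))) by (field; lra).
        apply Rmult_le_compat_l; lra. }
      apply Rmult_le_reg_r with (g / l); [apply Rdiv_lt_0_compat; lra|].
      replace ((K * E + 1) * l * (g / l)) with (K * (E * g) + g) by (field; lra).
      replace (nu k * (c * (7 / 120 * (l / ln 4)) - 1 - 27 / 80 * c) * (g / l))
        with (c * ((l / ln 4 - 3 / 2) * (9 / 40 * (nu k * (g / l))))
              - nu k * (g / l) - q * (c / 8) * (nu k * g))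
        by (unfold q; field; lra).
      lra. }
    (* Beyond [k0], a share c/120 of the factor 7c/120 absorbs the constants 1 + 27c/80, which
       leaves c/20. *)
    destruct (nfloor_ex (120 * (1 + c) / c)) as [k0 [_ Hk0]].
    { apply Rlt_le, Rdiv_lt_0_compat; lra. }
    (* The threshold is the bound on [nu k] that [Hkey] implies once c/20 is the remaining factor;
       exceeding it gives the contradiction. *)
    pose proof (proj2 (is_lim_seq_spec nu p_infty) Hlim
                  ((K * E + 1) / (c / (20 * ln 4)))) as [k1 Hk1].
    set (k := (S k0 + k1)%nat).
    specialize (Hkey k ltac:(unfold k; lia)).
    specialize (Hk1 k ltac:(unfold k; lia)).
    assert (Hkl : INR k * ln 4 <= ln (INR (n k))).
    { rewrite <- ln_pow by lra. apply ln_le; [apply pow_lt; lra|].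
      specialize (Hge2 k). pose proof (pow_lt 4 k). lra. }
    set (l := ln (INR (n k))) in *.
    assert (Hkc : 120 * (1 + c) <= c * INR k).
    { assert (Hk0' : 120 * (1 + c) / c <= INR k).
      { unfold k. rewrite plus_INR, S_INR. pose proof (pos_INR k1). lra. }
      apply Rmult_le_compat_l with (r := c) in Hk0'; [|lra].
      replace (c * (120 * (1 + c) / c)) with (120 * (1 + c)) in Hk0'
        by (field; lra).
      exact Hk0'. }
    assert (Hkl' : INR k <= l / ln 4).
    { apply Rmult_le_reg_r with (ln 4); [lra|].
      unfold Rdiv. rewrite Rmult_assoc, Rinv_l; lra. }
    assert (Hnuk : 0 < nu k) by (apply Hnu; unfold k; lia).
    assert (Hlk : 0 < l) by apply Hl.
    assert (Hcoef : c / 20 * (l / ln 4)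
      <= c * (7 / 120 * (l / ln 4)) - 1 - 27 / 80 * c) by nra.
    assert (Hcontr : nu k * (c / (20 * ln 4)) * l <= (K * E + 1) * l).
    { eapply Rle_trans; [|exact Hkey].
      replace (nu k * (c / (20 * ln 4)) * l) with (nu k * (c / 20 * (l / ln 4)))
        by (field; lra).
      apply Rmult_le_compat_l; lra. }
    apply Rmult_le_reg_r in Hcontr; [|exact Hlk].
    assert (Hd : 0 < c / (20 * ln 4)) by (apply Rdiv_lt_0_compat; lra).
    apply Rmult_lt_compat_r with (r := c / (20 * ln 4)) in Hk1; [|exact Hd].
    replace ((K * E + 1) / (c / (20 * ln 4)) * (c / (20 * ln 4)))
      with (K * E + 1) in Hk1 by (field; lra).
    lra.
Qed.
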